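(* Let $n\ge 1$, let $X$ be a connected separable metric space and let $x\in X$ be such that $\pi_n^{top}(X,x)$ is discrete. Then $\pi_n(X,x)$ is countable.
   Context: For a pointed space $(X,x)$ and $n\ge 1$, let $I=[0,1]$, let $\dot{I}^n$ be the boundary of $I^n$, and let $\mathrm{Hom}((I^n,\dot{I}^n),(X,x))$ be the set of continuous maps $f:I^n\to X$ with $f(\dot{I}^n)\subseteq\{x\}$, equipped with the compact-open topology, i.e. the topology with subbase the sets $\langle K,U\rangle=\{f : f(K)\subseteq U\}$, $K\subseteq I^n$ compact, $U\subseteq X$ open. Let $p_n:\mathrm{Hom}((I^n,\dot{I}^n),(X,x))\to\pi_n(X,x)$ be the surjection sending a map to its homotopy class relative to $\dot{I}^n$. $\pi_n^{top}(X,x)$ denotes the homotopy group $\pi_n(X,x)$ equipped with the quotient topology induced by $p_n$. *)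

(* Defs.v *)
From HB Require Import structures.
From mathcomp Require Import all_boot all_order all_algebra generic_quotient.
From mathcomp Require Import all_classical all_reals all_analysis.
From mathcomp Require Import lra.

Set Implicit Arguments.
Unset Strict Implicit.
Unset Printing Implicit Defensive.

Import Order.TTheory GRing.Theory Num.Theory.
Import numFieldNormedType.Exports.

Local Open Scope classical_set_scope.
Local Open Scope ring_scope.
Local Open Scope quotient_scope.

Definition cube (R : realType) (n : nat) : set 'rV[R]_n :=
  [set u | forall i, 0 <= u ord0 i <= 1].
Arguments cube : clear implicits.

(* The topological boundary of the cube in R^n, as a subset of the cube. *)
Definition cube_boundary (R : realType) (n : nat) : set (cube R n) :=
  [set u | (closure (cube R n) `\` interior (cube R n)) (\val u)].
Arguments cube_boundary : clear implicits.

(* As a type, [nloop R n x] carries the subspace topology inherited from the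
   compact-open topology on all functions from the cube to X. *)
Definition nloop (R : realType) (n : nat) (X : topologicalType) (x : X) :
    set {compact-open, cube R n -> X} :=
  [set f | continuous (f : cube R n -> X) /\
           f @` cube_boundary R n `<=` [set x]].
Arguments nloop R n {X} x.

Definition nloop_homotopic (R : realType) (n : nat) (X : topologicalType)
    (x : X) (f g : nloop R n x) : Prop :=
  exists H : cube R n * R -> X,
    [/\ {within [set: cube R n] `*` `[0, 1], continuous H},
        forall u, H (u, 0) = \val f u,
        forall u, H (u, 1) = \val g u &
        forall u (t : R), cube_boundary R n u -> t \in `[0, 1] -> H (u, t) = x].

Section within_slice.
Context {T X : topologicalType} {R : realType}.

Lemma within_slice_comp (A B : set R) (phi : R -> R) (H L : T * R -> X) :
  continuous phi -> (forall t, A t -> B (phi t)) ->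
  (forall u t, A t -> L (u, t) = H (u, phi t)) ->
  {within [set: T] `*` B, continuous H} ->
  {within [set: T] `*` A, continuous L}.
Proof.
move=> cphi AB LH /subspace_continuousP cH; apply/subspace_continuousP.
move=> [u t] /= [_ At]; rewrite /from_subspace LH // => W HW.
have := cH (u, phi t) (conj I (AB t At)) W HW.
rewrite /within /= !near_simpl => -[[P Q] /= [uP tQ] PQ].
exists (P, phi @^-1` Q) => /=; first by split=> //; exact: cphi.
move=> [v s] /= [Pv Qs] [_ As]; rewrite LH //.
exact: (PQ (v, phi s) (conj Pv Qs) (conj I (AB s As))).
Qed.

End within_slice.

Section homotopy_group.
Variables (R : realType) (n : nat) (X : topologicalType) (x : X).
Implicit Types f g h : nloop R n x.

Lemma nloopP f : continuous (\val f : cube R n -> X) /\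
  forall u, cube_boundary R n u -> \val f u = x.
Proof.
have [cf fx] := set_mem (valP f); split=> // u ub.
by apply: fx; exists u.
Qed.

Lemma nloop_homotopic_refl f : nloop_homotopic f f.
Proof.
have [cf fx] := nloopP f.
exists (fun p => \val f p.1); split=> // [|u t ub _]; last exact: fx.
apply: continuous_subspaceT => p.
by apply: (@continuous_comp _ _ _ fst); [exact: cvg_fst | exact: cf].
Qed.

Lemma nloop_homotopic_sym f g : nloop_homotopic f g -> nloop_homotopic g f.
Proof.
move=> [H [cH H0 H1 Hx]]; exists (fun p => H (p.1, 1 - p.2)); split.
- apply: (@within_slice_comp _ _ _ `[0, 1]%classic `[0, 1]%classic
      (fun t => 1 - t) H _ _ _ _ cH) => // t.
    by apply: cvgB; [exact: cvg_cst | exact: cvg_id].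
  by move=> /=; rewrite !in_itv /= => /andP[t0 t1]; apply/andP; split; lra.
- by move=> u; rewrite subr0.
- by move=> u; rewrite subrr.
- move=> u t ub; rewrite in_itv /= => /andP[t0 t1]; apply: Hx => //.
  by rewrite in_itv /=; apply/andP; split; lra.
Qed.

Lemma nloop_homotopic_trans f g h :
  nloop_homotopic f g -> nloop_homotopic g h -> nloop_homotopic f h.
Proof.
move=> [H [cH H0 H1 Hx]] [K [cK K0 K1 Kx]].
pose L (p : cube R n * R) :=
  if p.2 <= 2^-1 then H (p.1, 2 * p.2) else K (p.1, 2 * p.2 - 1).
have cM : continuous (fun t : R => 2 * t).
  by move=> t; apply: cvgM; [exact: cvg_cst | exact: cvg_id].
have cMB : continuous (fun t : R => 2 * t - 1).
  by move=> t; apply: cvgB; [exact: cM | exact: cvg_cst].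
have clos a b : closed ([set: cube R n] `*` `[a, b]%classic : set (_ * R)).
  rewrite setTX; apply: preimage_closed; last exact: interval_closed.
  by move=> p _; exact: cvg_snd.
exists L; split.
- have -> : [set: cube R n] `*` (`[0, 1]%classic : set R) =
      ([set: cube R n] `*` (`[0, 2^-1]%classic : set R)) `|`
      ([set: cube R n] `*` (`[2^-1, 1]%classic : set R)).
    apply/seteqP; split=> -[u t] /=; rewrite !in_itv /=.
      move=> [_ /andP[t0 t1]]; case: (leP t 2^-1) => t2.
        by left; split=> //; rewrite t0.
      by right; split=> //; rewrite t1 (ltW t2).
    by move=> [] [_ /andP[t0 t1]]; split=> //; apply/andP; split; lra.
  apply: withinU_continuous => //.
  + apply: (@within_slice_comp _ _ _ `[0, 2^-1]%classic `[0, 1]%classic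
      (fun t => 2 * t) H _ _ _ _ cH) => // [t|u t] /=;
      rewrite !in_itv /= => /andP[t0 t1].
      by apply/andP; split; lra.
    by rewrite /L /= t1.
  + apply: (@within_slice_comp _ _ _ `[2^-1, 1]%classic `[0, 1]%classic
      (fun t => 2 * t - 1) K _ _ _ _ cK) => // [t|u t] /=;
      rewrite !in_itv /= => /andP[t0 t1].
      by apply/andP; split; lra.
    rewrite /L /=; case: leP => // t2; have -> : t = 2^-1 by lra.
    by rewrite divff // subrr K0 H1.
- by move=> u; rewrite /L /= invr_ge0 ler0n mulr0 H0.
- move=> u; rewrite /L /= ifF; last by apply/negbTE; rewrite -ltNge; lra.
  by rewrite mulr1 (_ : 2 - 1 = 1 :> R) ?K1 //; lra.
- move=> u t ub; rewrite in_itv /= => /andP[t0 t1]; rewrite /L /=.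
  case: leP => t2; [apply: Hx | apply: Kx] => //;
    by rewrite in_itv /=; apply/andP; split; lra.
Qed.

Lemma nloop_homotopic_equiv :
  equiv_class_of (fun f g : nloop R n x => `[< nloop_homotopic f g >]).
Proof.
split=> [f|f g|g f h].
- exact/asboolP/nloop_homotopic_refl.
- by apply/asboolP/asboolP; exact: nloop_homotopic_sym.
- by move=> /asboolP fg /asboolP gh; apply/asboolP/(nloop_homotopic_trans fg gh).
Qed.

Definition nloop_homotopy_rel := EquivRelPack nloop_homotopic_equiv.

Definition pi_n : quotType (nloop R n x) := {eq_quot nloop_homotopy_rel}.

Definition pi_n_top : topologicalType := quotient_topology pi_n.

End homotopy_group.

Arguments pi_n R n {X} x.
Arguments pi_n_top R n {X} x.

(* Main.v *)
Require Import Defs.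
From HB Require Import structures.
From mathcomp Require Import all_boot all_order all_algebra generic_quotient finmap.
From mathcomp Require Import all_classical all_reals all_analysis.

Import Order.TTheory GRing.Theory Num.Theory.
Import numFieldNormedType.Exports.

Local Open Scope classical_set_scope.
Local Open Scope ring_scope.
Local Open Scope quotient_scope.

(** The space of loops is separable in a strong sense, so it cannot be cut into
    uncountably many open pieces.

    When the quotient is discrete, every homotopy class is open in the space of
    loops. The cube is compact, so near a continuous map the compact-open
    topology is refined by uniform convergence ([compact_open_nbhs_ball]): every
    loop [f] has a radius [1 / (k + 1)] such that all loops uniformly that close
    to [f] are homotopic to it.

    On the other hand, for each fixed radius the continuous maps from the cube
    to a separable metric space can be labelled by natural numbers in such a way
    that maps with the same label are uniformly within that radius
    ([continuous_maps_code]). Labelling a homotopy class by the radius of a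
    chosen representative together with the label of that representative for
    this radius is therefore injective: if two classes share a label, the
    representative of one is so close to that of the other that the classes
    coincide. *)

Lemma compact_set_typeT {T : topologicalType} {A : set T} :
  compact A -> compact [set: A].
Proof.
move=> cA F PF _.
have FA : (set_val @ F) A.
  apply: (@filterS _ F _ setT) => [u _|]; last exact: filterT.
  exact: set_mem (valP u).
have [p [Ap Fp]] := cA (set_val @ F) _ FA.
exists (SigSub (mem_set Ap)); split=> // P Q FP [_ [[W oW <-] Wp] WQ].
have [||_ [[u Pu <-] Wu]] := Fp (set_val @` P) W.
- by apply: (@filterS _ F _ P) => // u Pu; exists u.
- exact: open_nbhs_nbhs.
- by exists u; split=> //; exact: WQ.
Qed.

Lemma cube_compact (R : realType) (n : nat) : compact [set: cube R n].
Proof.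
apply: compact_set_typeT.
have -> : cube R n = [set v | forall i, `[0, 1]%classic (v ord0 i)].
  by apply/seteqP; split=> v v01 i; have := v01 i; rewrite /= in_itv.
exact: (@rV_compact R n (fun=> `[0, 1]%classic) (fun=> @segment_compact R 0 1)).
Qed.

(** At a continuous [f], a subbasic condition that [g @` K] lies in an open [O]
    survives small uniform perturbations, because the compact set [f @` K] has
    a uniform margin inside [O]. Finitely many such conditions are met on a
    whole uniform ball; the perturbed map [g] may be discontinuous. *)
Lemma compact_open_nbhs_ball {R : realType} {U : topologicalType}
    {V : pseudoMetricType R} {f : {compact-open, U -> V}}
    {P : set {compact-open, U -> V}} :
  continuous (f : U -> V) -> nbhs f P ->
  exists2 e : R, 0 < e &
    forall g : U -> V, (forall u, ball (f u) e (g u)) -> P g.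
Proof.
move=> cf fP.
pose F : set_system (U -> V) := nbhs (f : {uniform U -> V}).
have Ff : {family compact, F --> f}.
  by apply/fam_cvgP => K _; apply: (@uniform_subset_cvg _ _ _ setT).
have {}Ff : {compact-open, F --> f}.
  apply/compact_open_cvgP => K O cK oO fKO.
  apply: filterS (Ff _ (fam_compact_nbhs oO fKO cK cf)) => g gKO _ [u Ku <-].
  exact: gKO.
have /uniform_nbhs [E [entE EP]] := Ff _ fP.
move: entE; rewrite -entourage_ballE => -[e e0 eE].
by exists e => // g fg; apply: EP => u _; exact/eE/fg.
Qed.

(** Fix a countable basis of [U] and a countable dense set [D] in [V]. By
    compactness a continuous [f] is pinned down up to [e] by a finite table of
    pairs [(W, d)], where the basic open sets [W] cover [U] and [f] maps [W]
    into the ball of radius [e / 2] around [d] in [D]: two maps with the same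
    table are [e]-close at each point. There are countably many finite tables. *)
Lemma continuous_maps_code {R : realType} {U : ptopologicalType}
    {V : pseudoMetricType R} {D : set V} {e : R} :
  compact [set: U] -> @second_countable U -> countable D -> dense D ->
  0 < e ->
  exists c : (U -> V) -> nat, forall f g, continuous f -> continuous g ->
    c f = c g -> forall u, ball (f u) e (g u).
Proof.
move=> cU [B cB [oB bB]] cD dD e0.
have e4 : 0 < e / 2 / 2 by rewrite !divr_gt0.
pose table (f : U -> V) (S : set (set U * V)) :=
  (forall u, exists2 p, S p & p.1 u) /\
  (forall p, S p -> p.1 `<=` f @^-1` ball p.2 (e / 2)).
have tableP f : exists S, continuous f ->
    [/\ S `<=` B `*` D, finite_set S & table f S].
  have [cf|] := pselect (continuous f); last by exists set0.
  (* All admissible rows of a table for [f]: they cover [U], so finitely many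
     of them do. *)
  pose S0 := [set p | (B `*` D) p /\ p.1 `<=` f @^-1` ball p.2 (e / 2)].
  have S0cover : [set: U] `<=` cover S0 fst.
    move=> u _.
    (* Choosing [d] within [e / 4] of [f u] leaves room for [f] to vary by
       another [e / 4] around [u]. *)
    have [d [/interior_subset fud Dd]] :
        (ball (f u) (e / 2 / 2))^° `&` D !=set0.
      by apply: dD; [exists (f u); exact: nbhsx_ballx | exact: open_interior].
    have : nbhs u (f @^-1` ball d (e / 2)).
      apply: filterS (cf u _ (nbhsx_ballx (f u) _ e4)) => v /= fuv.
      by rewrite [e / 2]splitr; apply: ball_triangle fuv; exact: ball_sym.
    move=> /bB[W [BW Wu] Wd].
    by exists (W, d).
  have := cU; rewrite compact_cover => /(_ _ S0 fst _ S0cover)[|S SS0 Scover].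
    by move=> p [[Bp _] _]; exact: oB.
  exists [set` S] => _; split.
  - by move=> p /SS0/set_mem[].
  - exact: finite_fset.
  - split=> [u|p /SS0/set_mem[] //].
    by have [p Sp pu] := Scover u I; exists p.
have [S {}tableP] := choice tableP.
have /countable_injP[c cI] := countable_finite_subset (countableX cB cD).
exists (c \o S) => f g cf cg /= cfg u.
have [SfBD Sffin [Sfcover Sf]] := tableP f cf.
have [SgBD Sgfin [_ Sg]] := tableP g cg.
have {}cfg : S f = S g by apply: cI => //; exact: mem_set.
have [p Sp pu] := Sfcover u.
rewrite [e]splitr; apply: (@ball_triangle _ _ p.2).
  by apply: ball_sym; exact: Sf pu.
by apply: Sg pu; rewrite -cfg.
Qed.

Theorem theorem3p8 (R : realType) (n : nat) (X : metricType R) (x : X) :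
  (1 <= n)%N ->
  connected [set: X] ->
  (exists2 D : set X, countable D & dense D) ->
  (forall A : set (pi_n_top R n x), open A) ->
  countable [set: pi_n R n x].
Proof.
move=> _ _ [D cD dD] discrete.
have zeroP : (0 : 'rV[R]_n) \in cube R n.
  by apply/mem_set => i; rewrite mxE lexx ler01.
(* The covering lemmas are stated for pointed spaces: the cube is pointed at
   the origin. *)
pose K0 : pseudoMetricType R := cube R n.
pose K : pseudoPMetricType R := HB.pack K0 (isPointed.Build K0 (SigSub zeroP)).
have cK : compact [set: K] := @cube_compact R n.
have sK : @second_countable K := compact_second_countable cK.
have code k : exists c : (K -> X) -> nat, forall f g,
    continuous f -> continuous g -> c f = c g ->
    forall u, ball (f u) k.+1%:R^-1 (g u).
  by apply: (continuous_maps_code cK sK cD dD); rewrite invr_gt0 ltr0Sn.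
have {code}[c cP] := choice code.
have radius (a : pi_n R n x) : exists k : nat, forall g : nloop R n x,
    (forall u, ball (\val (repr a) u) k.+1%:R^-1 (\val g u)) ->
    \pi_(pi_n R n x) g = a.
  have [W oW Wa] : open (\pi_(pi_n R n x) @^-1` [set a] : set (nloop R n x)).
    exact: (discrete [set a]).
  have cf := (nloopP (repr a)).1.
  have fW : nbhs (\val (repr a) : {compact-open, cube R n -> X}) W.
    apply: open_nbhs_nbhs; split=> //.
    have : (set_val @^-1` W) (repr a) by rewrite Wa /= reprK.
    by [].
  have [e e0 eW] := compact_open_nbhs_ball cf fW.
  have [k ke] := ltr_add_invr e0.
  exists k => g fg.
  have : (set_val @^-1` W) g.
    apply: eW => u; apply: le_ball (fg u).
    by rewrite -[leLHS]add0r ltW.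
  by rewrite Wa.
have {radius}[k kP] := choice radius.
apply/countable_injP.
exists (fun a => choice.pickle (k a, c (k a) (\val (repr a)))).
move=> a b _ _ /(pcan_inj choice.pickleK)[kab]; rewrite -kab => cab.
rewrite -[b]reprK; apply/esym/kP.
exact: (cP (k a) _ _ (nloopP (repr a)).1 (nloopP (repr b)).1 cab).
Qed.
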